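(* Let $S<T$ be semigroups such that $P\cong P(T,S)$, and let $\sigma:T\to S$ be a retract. Then there is a semigroup $T'$ such that $P\cong P(T',T')$, i.e. $P$ is full.
   Context: For a semigroup $T$ and a subsemigroup $S<T$ ($S=T$ allowed), define $t\leq_S t' :\iff \exists s\in S:\ ts=t'$ on $T$. The notation $P(T,S)$ is used only when $\leq_S$ is a partial order on $T$, and then denotes the poset $(T,\leq_S)$. A retract $\sigma:T\to S$ is a semigroup endomorphism $\sigma$ of $T$ with $\sigma(T)=S$ and $\sigma|_S=\mathrm{id}_S$. A poset is full if it is isomorphic to $P(T',T')$ for some semigroup $T'$. *)

(* Defs.v *)
From HB Require Import structures.
From mathcomp Require Import all_boot all_order.
From mathcomp Require Import boolp classical_sets.

Set Implicit Arguments.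
Unset Strict Implicit.
Unset Printing Implicit Defensive.

Local Open Scope classical_set_scope.
Local Open Scope group_scope.

(* Neither semigroups nor subsemigroups are required to be nonempty; if leS S
   is reflexive on a nonempty T, then S is nonempty. *)
Definition subsemigroup (T : semigroupType) (S : set T) : Prop :=
  mulg_closed [in S].

Definition leS (T : semigroupType) (S : set T) (t t' : T) : Prop :=
  exists2 s, S s & t * s = t'.

Definition is_partial_order (T : Type) (R : T -> T -> Prop) : Prop :=
  [/\ forall x, R x x,
      forall x y, R x y -> R y x -> x = y
    & forall x y z, R x y -> R y z -> R x z].

(* P(T, S): the carrier T ordered by leS S. The proof argument makes the poset
   available only when leS S is a partial order. *)
Definition cayley_poset (T : semigroupType) (S : set T)
  (po : is_partial_order (leS S)) : Type := T.

Section CayleyPoset.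
Variables (T : semigroupType) (S : set T) (po : is_partial_order (leS S)).

HB.instance Definition _ := Choice.on (cayley_poset po).

Definition cayley_le (x y : cayley_poset po) : bool := `[< leS S x y >].

Lemma cayley_le_refl : reflexive cayley_le.
Proof. by have [rf _ _] := po; move=> x; apply/asboolP. Qed.

Lemma cayley_le_anti : antisymmetric cayley_le.
Proof.
have [_ an _] := po.
by move=> x y /andP[/asboolP xy /asboolP yx]; exact: an.
Qed.

Lemma cayley_le_trans : transitive cayley_le.
Proof.
have [_ _ tr] := po.
by move=> y x z /asboolP xy /asboolP yz; apply/asboolP/(tr _ y).
Qed.

Fact cayley_display : Order.disp_t. Proof. exact: Order.Disp tt tt. Qed.

HB.instance Definition _ := Order.Le_isPOrder.Build cayley_display
  (cayley_poset po) cayley_le_refl cayley_le_anti cayley_le_trans.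

End CayleyPoset.

Definition poset_iso (d d' : Order.disp_t) (P : porderType d)
    (Q : porderType d') : Prop :=
  exists2 f : P -> Q, bijective f & {mono f : x y / (x <= y)%O}.

Definition full_poset (d : Order.disp_t) (P : porderType d) : Prop :=
  exists (T : semigroupType) (po : is_partial_order (leS [set: T])),
    poset_iso P (cayley_poset po).

Definition is_retract (T : semigroupType) (S : set T)
    (sigma : {multiplicative T -> T}) : Prop :=
  range sigma = S /\ {in S, forall s, sigma s = s}.

(* Main.v *)
Require Import Defs.
From HB Require Import structures.
From mathcomp Require Import all_boot all_order.
From mathcomp Require Import boolp classical_sets.

(** Twist the product of T by the retract, putting x *' y := x * sigma y.
    Since sigma is an idempotent endomorphism, *' is associative:
    both (x *' y) *' z and x *' (y *' z) equal x * sigma y * sigma z.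
    Since the image of sigma is S, right multiplication by an arbitrary
    element for *' is the same thing as right multiplication by an element
    of S for the original product. Hence the order of the twisted semigroup
    acting on itself is literally the order leS S on T. *)

Section Twist.
Variables (T : semigroupType) (sigma : {multiplicative T -> T}).

Local Open Scope group_scope.

(** The carrier of the twisted semigroup: a copy of T, indexed by a proof
    that sigma is idempotent, which is what associativity needs. *)
Definition twist (sigmaK : forall x, sigma (sigma x) = sigma x) : Type := T.

Variable sigmaK : forall x, sigma (sigma x) = sigma x.

HB.instance Definition _ := Choice.on (twist sigmaK).

(** The twisted product x *' y. *)
Definition twist_mul (x y : twist sigmaK) : twist sigmaK :=
  (x : T) * sigma y.

Lemma twist_mulA : associative twist_mul.
Proof. by move=> x y z; rewrite /twist_mul gmulfM sigmaK mulgA. Qed.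

HB.instance Definition _ := hasMul.Build (twist sigmaK) twist_mul.
HB.instance Definition _ := Magma_isSemigroup.Build (twist sigmaK) twist_mulA.

Lemma leS_twist :
  leS [set: twist sigmaK]%classic = leS (range sigma) :> (T -> T -> Prop).
Proof.
apply/funext => x; apply/funext => y; apply/propext; split.
  by case=> t _ <-; exists (sigma t) => //; exists t.
by case=> _ [t _ <-] <-; exists t.
Qed.

End Twist.

Lemma is_retract_idem (T : semigroupType) (S : set T)
    (sigma : {multiplicative T -> T}) (retr : is_retract S sigma) (x : T) :
  sigma (sigma x) = sigma x.
Proof. by case: retr => <- fixS; apply: fixS; apply: mem_set; exists x. Qed.

Theorem proposition4p4 (d : Order.disp_t) (P : porderType d)
    (T : semigroupType) (S : set T) (subS : subsemigroup S)
    (po : is_partial_order (leS S)) (isoP : poset_iso P (cayley_poset po))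
    (sigma : {multiplicative T -> T}) (retr : is_retract S sigma) :
  full_poset P.
Proof.
pose T' : semigroupType := twist _ _ (is_retract_idem _ _ _ retr).
have leE : leS [set: T']%classic = leS S :> (T -> T -> Prop).
  by rewrite leS_twist; have [-> _] := retr.
have po' : is_partial_order (leS [set: T']%classic) by rewrite leE.
exists T', po'.
have [f bij_f mono_f] := isoP.
(* The carrier and the order are unchanged, so f itself is an isomorphism. *)
exists (f : P -> cayley_poset po') => // x y.
rewrite -mono_f; congr (`[< _ >]).
by rewrite leE.
Qed.
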